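(* Let $n$ be a positive integer with $n \equiv 0 \pmod 8$. Let $C$ be a near-extremal Type I code of length $n$ and let $C'$ be a near-extremal even formally self-dual code of length $n$. Then for every nonzero weight $w$, the support design $C_w$ is a $1$-design, and $C'_w \cup C'^{\perp}_w$ is a $1$-design.
   Context: All codes are binary linear codes, i.e. subspaces of $\mathbb{F}_2^n$; $\mathrm{wt}(x)$ is the number of nonzero coordinates of $x$; the dual $C^\perp$ is taken with respect to $(x,y)=\sum_i x_iy_i$. A code is even if all its weights are even, and doubly even if all its weights are divisible by $4$. A Type I code is a self-dual code ($C=C^\perp$) that is not doubly even. An even formally self-dual code is an even code having the same weight distribution as its dual code. A Type I or even formally self-dual code of length $n$ is near-extremal if its minimum distance equals $d=2\lfloor n/8\rfloor$. For a code $C$ of length $n$ and a nonzero weight $w$, the support design $C_w$ has point set $\{1,\dots,n\}$ and its blocks are the supports $\mathrm{supp}(c)=\{i : c_i\neq 0\}$ of all codewords $c\in C$ with $\mathrm{wt}(c)=w$. The union $C'_w\cup C'^{\perp}_w$ is the union of the two block collections counted with multiplicity: a $w$-set which is the support of a word of $C'$ and also of a word of $C'^\perp$ is counted twice. A $t$-$(v,k,\lambda)$ design (a $t$-design) consists of a set of $v$ points and a collection (multiset) of $k$-element subsets called blocks such that any $t$ points are contained in exactly $\lambda$ blocks (with multiplicity); the empty collection is regarded as a $t$-design with $\lambda=0$. *)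

(* Defs.v *)
From HB Require Import structures.
From mathcomp Require Import all_boot all_order all_algebra.

Set Implicit Arguments.
Unset Strict Implicit.
Unset Printing Implicit Defensive.

Import GRing.Theory.
Local Open Scope ring_scope.

Section Codes.
Variable n : nat.
Implicit Types (x y : 'rV['F_2]_n) (C : {vspace 'rV['F_2]_n}).

Definition supp x : {set 'I_n} := [set i | x 0 i != 0].

Definition wt x : nat := #|supp x|.

Definition hamming_dist x y : nat := #|[set i | x 0 i != y 0 i]|.

Definition inner x y : 'F_2 := \sum_i x 0 i * y 0 i.

(* The kernel of [mulmxr y^T] is the space of all x with (x, y) = 0; see
   [mem_dual_code]. *)
Definition dual_code C : {vspace 'rV['F_2]_n} :=
  (\bigcap_(y in C) lker (linfun (mulmxr y^T : 'rV_n -> 'rV_1)))%VS.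

Lemma mem_dual_code C x :
  x \in dual_code C <-> (forall y, y \in C -> inner x y = 0).
Proof.
have innerE y : (x *m y^T == 0) = (inner x y == 0).
  have -> : (x *m y^T) = (inner x y)%:M.
    apply/matrixP=> i j; rewrite !ord1 !mxE eqxx mulr1n /inner.
    by apply: eq_bigr => k _; rewrite mxE.
  apply/eqP/eqP=> [/matrixP/(_ 0 0)|->]; last exact: raddf0.
  by rewrite !mxE eqxx mulr1n.
rewrite memvE; split=> [/subv_bigcapP H y yC | H].
  by have := H y yC; rewrite -memvE memv_ker lfunE /= innerE => /eqP.
by apply/subv_bigcapP=> y yC; rewrite -memvE memv_ker lfunE /= innerE H.
Qed.

Definition even_code C : Prop := forall x, x \in C -> (2 %| wt x)%N.

Definition doubly_even C : Prop := forall x, x \in C -> (4 %| wt x)%N.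

Definition self_dual C : Prop := C = dual_code C.

Definition type_I C : Prop := self_dual C /\ ~ doubly_even C.

Definition weight_distribution C (w : nat) : nat :=
  #|[set x : 'rV['F_2]_n | (x \in C) && (wt x == w)]|.

Definition even_formally_self_dual C : Prop :=
  even_code C /\
  forall w, weight_distribution C w = weight_distribution (dual_code C) w.

(* Relational, so that the zero code has no minimum distance. *)
Definition has_min_distance C (d : nat) : Prop :=
  (exists x y, [/\ x \in C, y \in C, x != y & hamming_dist x y = d]) /\
  (forall x y, x \in C -> y \in C -> x != y -> (d <= hamming_dist x y)%N).

Definition near_extremal C : Prop := has_min_distance C (2 * (n %/ 8))%N.

(* Block collections are sequences, read as multisets. *)
Definition support_blocks C (w : nat) : seq {set 'I_n} :=
  [seq supp x | x <- enum [set x : 'rV['F_2]_n | (x \in C) && (wt x == w)]].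

End Codes.

Definition is_t_design (P : finType) (t v k lambda : nat) (B : seq {set P})
  : Prop :=
  [/\ #|P| = v,
      (forall b, b \in B -> #|b| = k) &
      (forall T : {set P}, #|T| = t -> count (fun b : {set P} => T \subset b) B = lambda)].

Definition t_design (P : finType) (t : nat) (B : seq {set P}) : Prop :=
  exists v k lambda, is_t_design t v k lambda B.

(* Main.v *)
Require Import Defs.
From HB Require Import structures.
From mathcomp Require Import all_boot all_order all_algebra.
From mathcomp Require Import ring lra zify.

Import GRing.Theory Num.Theory.
Local Open Scope ring_scope.

(** Fix coordinates i != j and put h(x) = [x_i <> 0] - [x_j <> 0], a harmonic
    function of degree 1 on subsets. All points of a block collection have the
    same degree as soon as h sums to 0 over its words for all i and j, so the
    theorem says that the polynomial g = sum of h(x) 'X^(wt x - 1), with x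
    running through C' and then through its dual, is zero. A self-dual C is
    even and formally self-dual, and C together with its dual is C counted
    twice, so the first half is the case C' = C of the second.

    Poisson summation over the code ([poisson_summation]) and the Fourier
    transform of h(x) 'X^(wt x) ([fourier_hdiff]) give a MacWilliams identity
    with an extra sign, due to the odd degree of h ([macwilliams_hdiff],
    [horner_hpoly_dual]). For g it reads
      2^(n/2) g(t) = - 2 (1 + t)^(n-2) g((1 - t) / (1 + t)).

    Write u = n/4 - 1. Both codes contain the all-one word, so the minimum
    distance n/4 confines the words with h(x) <> 0 to even weights between n/4
    and 3n/4. Hence 'X^u divides g and g has degree at most 3u + 2; and since
    1 - t and 1 + t occur at least u times in each term of the transformed sum,
    (1 - 'X)^u and (1 + 'X)^u divide g as well. So g = ('X (1 - 'X^2))^u Q with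
    Q of degree at most 2. As g and u are odd, Q is even. The substitution
    t |-> (1 - t) / (1 + t) preserves t (1 - t^2) up to the factor
    4 / (1 + t)^4, so it leaves for Q the equation
      2 Q(t) = - (1 + t)^2 Q((1 - t) / (1 + t)),
    which no nonzero even quadratic satisfies ([antiinvariant_eq0]). This
    elementary argument replaces the computation of the relative invariants of
    the dihedral group of order 16. *)

Set Implicit Arguments.
Unset Strict Implicit.
Unset Printing Implicit Defensive.

(** * Polynomials antiinvariant under the MacWilliams substitution *)

Lemma dvdp_sum (I : finType) (A : {pred I}) (F : I -> {poly rat})
    (p : {poly rat}) :
  (forall k, k \in A -> p %| F k) -> p %| \sum_(k in A) F k.
Proof.
move=> dvdF; apply: (big_ind (fun q => p %| q)) => //.
  by move=> q r; exact: dvdp_add.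
Qed.

Lemma dvdp_three_roots (u : nat) (g : {poly rat}) :
  'X ^+ u %| g -> (1 - 'X) ^+ u %| g -> (1 + 'X) ^+ u %| g ->
  ('X * ((1 - 'X) * (1 + 'X))) ^+ u %| g.
Proof.
move=> X_dvd Xm_dvd Xp_dvd.
have co1 : coprimep (1 - 'X) (1 + 'X : {poly rat}).
  apply/Bezout_eq1_coprimepP; exists (2^-1%:P, 2^-1%:P) => /=.
  rewrite -mulrDr addrACA addNr addr0 -[1 + 1]/(2%:R) -polyC_natr -polyCM.
  by rewrite mulVf.
have co2 : coprimep 'X ((1 - 'X) * (1 + 'X) : {poly rat}).
  by apply/Bezout_eq1_coprimepP; exists ('X, 1) => /=; ring.
rewrite exprMn Gauss_dvdp ?coprimep_expl ?coprimep_expr // X_dvd /=.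
by rewrite exprMn Gauss_dvdp ?coprimep_expl ?coprimep_expr // Xm_dvd.
Qed.

(** Homogeneously, the linear forms x, y, x - y and x + y are permuted up to
    scalars by the symmetries y |-> -y and (x, y) |-> (x + y, x - y). After
    setting x = 1 and y = 'X, divisibility by the u-th powers of the last three
    and the bound on the degree leave a quadratic cofactor, which has the wrong
    sign under the second symmetry. *)
Lemma antiinvariant_eq0 (u : nat) (g : {poly rat}) :
  odd u -> (size g <= 3 * u + 3)%N ->
  'X ^+ u %| g -> (1 - 'X) ^+ u %| g -> (1 + 'X) ^+ u %| g ->
  (forall x, g.[- x] = - g.[x]) ->
  (forall x, 1 + x != 0 ->
     2 ^+ (2 * u + 1) * g.[x]
     = - ((1 + x) ^+ (4 * u + 2) * g.[(1 - x) / (1 + x)])) ->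
  g = 0.
Proof.
move=> odd_u size_g X_dvd Xm_dvd Xp_dvd g_odd g_inv.
have /dvdpP[Q gE] := dvdp_three_roots X_dvd Xm_dvd Xp_dvd.
set P := 'X * _ in gE.
have PE x : P.[x] = x * ((1 - x) * (1 + x)) by rewrite !hornerE.
have [Q0|Q_neq0] := eqVneq Q 0; first by rewrite gE Q0 mul0r.
have size_P : size P = 4%N.
  have -> : P = - ('X ^+ 3 - 'X) by rewrite /P; ring.
  rewrite size_polyN size_polyDl ?size_polyXn // size_polyN size_polyX //.
have size_Q : (size Q <= 3)%N.
  have P_neq0 : P ^+ u != 0 by rewrite expf_neq0 // -size_poly_gt0 size_P.
  have size_Pu := size_exp P u; rewrite size_P in size_Pu.
  move: size_g; rewrite gE size_mul //.
  move: P_neq0; rewrite -size_poly_gt0.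
  move: size_Pu; rewrite /=; move: (size (P ^+ u)) (size Q) => s q; lia.
have QE x : Q.[x] = Q`_0 + Q`_1 * x + Q`_2 * x ^+ 2.
  by rewrite (horner_coef_wide _ size_Q) !big_ord_recr big_ord0 /= add0r mulr1.
(* The oddness of u makes the cofactor P ^+ u change sign together with g. *)
have Q_even x : x * ((1 - x) * (1 + x)) != 0 -> Q.[- x] = Q.[x].
  move=> nz; have := g_odd x; rewrite gE !hornerM !horner_exp !PE.
  have -> : - x * ((1 - - x) * (1 + - x)) = - (x * ((1 - x) * (1 + x))) by ring.
  rewrite exprNn -signr_odd odd_u mulN1r mulrN => /oppr_inj.
  by apply: mulIf; rewrite expf_neq0.
have Q_inv x : x * ((1 - x) * (1 + x)) != 0 ->
    2 * Q.[x] = - ((1 + x) ^+ 2 * Q.[(1 - x) / (1 + x)]).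
  move=> nz; have nz1 : 1 + x != 0.
    by apply: contraNneq nz => ->; rewrite !mulr0.
  have := g_inv x nz1; rewrite gE !hornerM !horner_exp !PE.
  set y := (1 - x) / (1 + x); rewrite 2!exprD 2!exprM expr1.
  (* x (1 - x^2) is a multiple of itself after the substitution, with positive
     sign, so the minus sign of the functional equation is left to Q. *)
  have yE : (1 + x) ^+ 4 * (y * ((1 - y) * (1 + y))) =
            2 ^+ 2 * (x * ((1 - x) * (1 + x))).
    by rewrite /y; field.
  move: nz yE; set p := x * _; set q := y * _ => nz yE.
  have yEu : ((1 + x) ^+ 4) ^+ u * q ^+ u = (2 ^+ 2) ^+ u * p ^+ u.
    by rewrite -!exprMn yE.
  have nz2 : (2 ^+ 2) ^+ u * p ^+ u != 0.
    by rewrite mulf_neq0 ?expf_neq0.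
  move=> E; apply: (mulIf nz2); rewrite mulNr -{2}yEu.
  move: E; set a := (2 ^+ 2) ^+ u; set b := ((1 + x) ^+ 4) ^+ u => E.
  transitivity (a * 2 * (Q.[x] * p ^+ u)); first by ring.
  by rewrite E; ring.
(* Besides x = 0, 1 and -1, where P vanishes, any points giving independent
   equations would do. *)
have quadratic0 (a b c : rat) (f := fun x => a + b * x + c * x ^+ 2) :
    f (- 2) = f 2 -> 2 * f 2 = - ((1 + 2) ^+ 2 * f ((1 - 2) / (1 + 2))) ->
    2 * f 3 = - ((1 + 3) ^+ 2 * f ((1 - 3) / (1 + 3))) ->
    [/\ a = 0, b = 0 & c = 0].
  rewrite /f => E1 E2 E3; have b0 : b = 0 by lra.
  have y2 : (1 - 2) / (1 + 2) = - 3^-1 :> rat by apply/eqP.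
  have y3 : (1 - 3) / (1 + 3) = - 2^-1 :> rat by apply/eqP.
  by rewrite b0 ?y2 ?y3 in E2 E3 *; split; lra.
have [c0 c1 c2] : [/\ Q`_0 = 0, Q`_1 = 0 & Q`_2 = 0].
  by apply: quadratic0; rewrite -!QE; [apply: Q_even|apply: Q_inv|apply: Q_inv].
case/eqP: Q_neq0; apply/polyP => k; rewrite coef0.
by case: k => [|[|[|k]]] //; apply: nth_default; apply: leq_trans size_Q _.
Qed.

Section HarmonicEnumerators.
Variable n : nat.
Implicit Types (u v x y : 'rV['F_2]_n) (C : {vspace 'rV['F_2]_n}).

(** * Fourier analysis on binary codes *)

Definition chi (a : 'F_2) : rat := if a == 0 then 1 else -1.

Lemma F2_cases (a : 'F_2) : a = 0 \/ a = 1.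
Proof. by case: a => [[|[|//]] ?]; [left | right]; apply/val_inj. Qed.

Lemma chiD (a b : 'F_2) : chi (a + b) = chi a * chi b.
Proof. by case: (F2_cases a) => ->; case: (F2_cases b) => ->. Qed.

Lemma chi_sum (I : Type) (r : seq I) (P : pred I) (f : I -> 'F_2) :
  chi (\sum_(i <- r | P i) f i) = \prod_(i <- r | P i) chi (f i).
Proof. exact: (big_morph chi chiD). Qed.

Lemma innerC x y : inner x y = inner y x.
Proof. by apply: eq_bigr => k _; rewrite mulrC. Qed.

Lemma innerDl x y v : inner (x + y) v = inner x v + inner y v.
Proof. by rewrite -big_split; apply: eq_bigr => k _; rewrite mxE mulrDl. Qed.

(** Orthogonality of characters: translating by a codeword y with (y, v) = 1
    changes the sign of the sum. *)
Lemma sum_chi_code C v :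
  \sum_(x in C) chi (inner x v) = if v \in dual_code C then #|C|%:R else 0.
Proof.
case: ifP => [/mem_dual_code vD | /negP vND].
  rewrite -sum1_card natr_sum; apply: eq_bigr => x xC.
  by rewrite innerC (vD _ xC).
have [y yC yv] : exists2 y, y \in C & inner y v = 1.
  have [/existsP[y /andP[yC yv]]|/existsPn none] :=
    boolP [exists y, (y \in C) && (inner y v == 1)].
    by exists y => //; apply/eqP.
  case: vND; apply/mem_dual_code => y yC; rewrite innerC.
  by case: (F2_cases (inner y v)) => // yv; move: (none y); rewrite yC yv.
set S := \sum_(x in C) _.
suff: S = - S by lra.
rewrite {1}/S (reindex_inj (addrI y)) /= -sumrN.
apply: eq_big => [x|x _]; first by rewrite rpredDl.
by rewrite innerDl chiD yv mulN1r.
Qed.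

Lemma poisson_summation (V : lmodType rat) (F : 'rV['F_2]_n -> V) C :
  \sum_(x in C) \sum_v chi (inner x v) *: F v
  = #|C|%:R *: \sum_(v in dual_code C) F v.
Proof.
rewrite exchange_big /= scaler_sumr [RHS]big_mkcond /=.
apply: eq_bigr => v _; rewrite -scaler_suml sum_chi_code.
by case: ifP => // _; rewrite scale0r.
Qed.

(** A sum over all vectors of a product of functions of single coordinates
    factors; this evaluates all the Fourier transforms below. *)
Lemma sum_row_prod (R : comNzRingType) (F : 'I_n -> 'F_2 -> R) :
  \sum_(v : 'rV['F_2]_n) \prod_k F k (v 0 k) = \prod_k (F k 0 + F k 1).
Proof.
have sumF2 (f : 'F_2 -> R) : \sum_a f a = f 0 + f 1.
  rewrite (bigD1 0) // (bigD1 1) //= big1 ?addr0 // => a.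
  by case: (F2_cases a) => ->.
under [RHS]eq_bigr do rewrite -sumF2.
rewrite bigA_distr_bigA /=.
rewrite (reindex (fun f : {ffun 'I_n -> 'F_2} => \row_k f k)) /=.
  by apply: eq_bigr => f _; apply: eq_bigr => k _; rewrite mxE.
exists (fun v : 'rV['F_2]_n => [ffun k => v 0 k]) => [f _|v _].
  by apply/ffunP=> k; rewrite ffunE mxE.
by apply/rowP=> k; rewrite mxE ffunE.
Qed.

(** Poisson summation for the constant function 1, whose Fourier transform is
    concentrated at 0. *)
Lemma card_dual_code C : (#|C| * #|dual_code C| = 2 ^ n)%N.
Proof.
apply/eqP; rewrite -(eqr_nat rat) natrM.
have <- : \sum_(x in C) \sum_v chi (inner x v) *: (1 : rat^o)
          = #|C|%:R * #|dual_code C|%:R.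
  by rewrite (@poisson_summation rat^o (fun=> 1)) sumr_const.
rewrite (bigD1 0) ?mem0v //= [X in _ + X]big1 => [|x /andP[_ x_neq0]].
  rewrite addr0 (eq_bigr (fun=> 1)) => [|v _].
    by rewrite sumr_const card_mx card_Fp // mul1n.
  by rewrite /inner big1 ?scale1r // => k _; rewrite mxE mul0r.
under eq_bigr do rewrite [_ *: _]mulr1 /inner chi_sum.
rewrite (@sum_row_prod rat (fun k a => chi (x 0 k * a))).
have [k xk] : exists k, x 0 k = 1.
  have [/existsP[k /eqP xk]|/existsPn none] := boolP [exists k, x 0 k == 1].
    by exists k.
  case/eqP: x_neq0; apply/rowP => k; rewrite mxE.
  by case: (F2_cases (x 0 k)) => // xk; move: (none k); rewrite xk.
by rewrite (bigD1 k) //= xk mulr0 mulr1 mul0r.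
Qed.

Lemma dual_codeK C : dual_code (dual_code C) = C.
Proof.
have sub : (C <= dual_code (dual_code C))%VS.
  apply/subvP => x xC; apply/mem_dual_code => y /mem_dual_code yD.
  by rewrite innerC yD.
have cardE : #|dual_code (dual_code C)| = #|C|.
  have card_gt0 : (0 < #|dual_code C|)%N.
    by apply/card_gt0P; exists 0; rewrite mem0v.
  apply/eqP; rewrite -(eqn_pmul2l card_gt0) card_dual_code mulnC.
  by rewrite card_dual_code.
apply/eqP; rewrite eqEsubv sub andbT.
have subC : C \subset dual_code (dual_code C).
  by apply/subsetP => y /(subvP sub).
by apply/subvP => x; rewrite (subset_cardP (esym cardE) subC).
Qed.

(** * Fourier transform of the harmonic function of degree 1 *)

Definition hdiff (i j : 'I_n) x : rat := (x 0 i != 0)%:R - (x 0 j != 0)%:R.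

Lemma prod_chi (z : {poly rat}) x :
  \prod_k (1 + chi (x 0 k) *: z) = (1 - z) ^+ wt x * (1 + z) ^+ (n - wt x).
Proof.
rewrite (bigID (mem (supp x))) /=; congr (_ * _).
  rewrite -prodr_const; apply: eq_bigr => k; rewrite inE => xk.
  by rewrite /chi (negPf xk) scaleN1r.
have <- : #|~: supp x| = (n - wt x)%N by rewrite cardsCs setCK card_ord.
rewrite -prodr_const; apply: eq_big => [k|k]; first by rewrite !inE.
by rewrite inE negbK => /eqP ->; rewrite scale1r.
Qed.

(** The summand is a product over the coordinates, where coordinate i
    contributes only for v_i = 1. *)
Lemma fourier_coord (i : 'I_n) x :
  \sum_v chi (inner x v) *: ((v 0 i != 0)%:R *: 'X ^+ wt v : {poly rat})
  = chi (x 0 i) *: 'X * \prod_(k | k != i) (1 + chi (x 0 k) *: 'X).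
Proof.
pose F (k : 'I_n) (a : 'F_2) : {poly rat} :=
  chi (x 0 k * a) *: (((k == i) ==> (a != 0))%:R *: 'X ^+ (a != 0)).
transitivity (\sum_(v : 'rV['F_2]_n) \prod_k F k (v 0 k)).
  apply: eq_bigr => v _; rewrite /F !scaler_prod; congr (_ *: _).
    by rewrite /inner chi_sum.
  congr (_ *: _).
    rewrite (bigD1 i) //= eqxx /= big1 ?mulr1 // => k /negPf -> //.
  rewrite prodrXr /wt -sum1_card big_mkcond /=; congr (_ ^+ _).
  by apply: eq_bigr => k _; rewrite inE; case: (v 0 k == 0).
rewrite sum_row_prod (bigD1 i) //= /F eqxx /=.
rewrite scale0r scaler0 add0r !mulr1 scale1r; congr (_ * _).
by apply: eq_bigr => k /negPf ->; rewrite /= !mulr0 mulr1 !scale1r.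
Qed.

(** Because of this, the truncated subtractions in the exponents below never
    matter: wherever they would truncate, h is zero. *)
Lemma hdiff_wt (i j : 'I_n) x : hdiff i j x != 0 -> (0 < wt x < n)%N.
Proof.
move=> hx; have [k [l [xk xl]]] : exists k l, x 0 k != 0 /\ x 0 l = 0.
  move: hx; rewrite /hdiff; have [xi|xi] := eqVneq (x 0 i) 0.
    by have [xj|xj] := eqVneq (x 0 j) 0; rewrite ?subrr ?eqxx //; exists j, i.
  by have [xj|xj] := eqVneq (x 0 j) 0; rewrite ?subrr ?eqxx //; exists i, j.
apply/andP; split; first by apply/card_gt0P; exists k; rewrite inE.
rewrite -[X in (_ < X)%N]card_ord -cardsT; apply: proper_card.
by rewrite properT; apply/eqP => /setP/(_ l); rewrite !inE xl eqxx.
Qed.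

(** Up to a factor depending only on the weight, the Fourier transform
    reproduces h. Next to the product over k != i, j that they share, the values
    of [fourier_coord] at i and j leave 'X (chi(x_i) - chi(x_j)) = -2 'X h(x);
    and where h(x) <> 0, the shared product lacks exactly one factor 1 - 'X and
    one factor 1 + 'X of the product over all coordinates. *)
Lemma fourier_hdiff (i j : 'I_n) x : i != j ->
  \sum_v chi (inner x v) *: (hdiff i j v *: 'X ^+ wt v : {poly rat})
  = hdiff i j x *:
      ((-2) *: 'X * ((1 - 'X) ^+ (wt x).-1 * (1 + 'X) ^+ (n - wt x).-1)).
Proof.
move=> neq_ij.
transitivity ((chi (x 0 i) - chi (x 0 j)) *: 'X *
              \prod_(k | (k != i) && (k != j)) (1 + chi (x 0 k) *: 'X)
              : {poly rat}).
  under [LHS]eq_bigr do rewrite /hdiff scalerBl scalerBr.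
  rewrite sumrB !fourier_coord (bigD1 j) 1?eq_sym //=.
  rewrite [X in _ - _ * X](bigD1 i) //=.
  rewrite [X in _ - _ * (_ * X)](eq_bigl (fun k => (k != i) && (k != j)));
    last by move=> k; rewrite andbC.
  set P := \prod_(_ | _) _; rewrite -!mul_polyC polyCB; ring.
have -> : chi (x 0 i) - chi (x 0 j) = -2 * hdiff i j x.
  rewrite /chi /hdiff; by do 2 case: (_ == _) => /=; ring.
have [->|hx] := eqVneq (hdiff i j x) 0; first by rewrite mulr0 !scale0r mul0r.
set P := \prod_(_ | _) _.
suff -> : P = (1 - 'X) ^+ (wt x).-1 * (1 + 'X) ^+ (n - wt x).-1.
  rewrite -!mul_polyC polyCM; ring.
have nz (c : rat) : 1 + c *: 'X != 0 :> {poly rat}.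
  by apply/eqP => /(congr1 (horner^~ 0)); rewrite !hornerE => /eqP.
have nz1 : 1 - 'X != 0 :> {poly rat} by rewrite -scaleN1r nz.
have nz2 : 1 + 'X != 0 :> {poly rat} by rewrite -['X]scale1r nz.
apply: (mulIf (mulf_neq0 nz1 nz2)).
have [wt_gt0 wt_ltn] := andP (hdiff_wt hx).
rewrite mulrACA -!exprSr prednK // prednK ?subn_gt0 // -prod_chi.
rewrite (bigD1 i) //= (bigD1 j) 1?eq_sym //= [RHS]mulrA [RHS]mulrC.
congr (_ * _).
move: hx; rewrite /hdiff /chi.
by case: (x 0 i == 0); case: (x 0 j == 0); rewrite ?subrr ?eqxx //= => _;
  rewrite scale1r scaleN1r // mulrC.
Qed.

(** * MacWilliams identity *)

(** The harmonic weight enumerator of the code for h, divided by 'X; the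
    predecessor in the exponent is harmless as h vanishes on the zero word. *)
Definition hpoly (i j : 'I_n) C : {poly rat} :=
  \sum_(x in C) hdiff i j x *: 'X ^+ (wt x).-1.

(** The same enumerator after the MacWilliams substitution
    (x, y) |-> (x + y, x - y) in its homogeneous form. *)
Definition hpoly_dual (i j : 'I_n) C : {poly rat} :=
  \sum_(x in C)
    hdiff i j x *: ((1 - 'X) ^+ (wt x).-1 * (1 + 'X) ^+ (n - wt x).-1).

Lemma macwilliams_hdiff (i j : 'I_n) C : i != j ->
  #|C|%:R *: hpoly i j (dual_code C) = (-2) *: hpoly_dual i j C.
Proof.
move=> neq_ij; apply: (mulfI (negbT (polyX_eq0 rat))).
transitivity (#|C|%:R *: \sum_(v in dual_code C)
                hdiff i j v *: 'X ^+ wt v : {poly rat}).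
  rewrite -scalerAr; congr (_ *: _); rewrite mulr_sumr.
  apply: eq_bigr => v _; have [->|hv] := eqVneq (hdiff i j v) 0.
    by rewrite !scale0r mulr0.
  have /andP[wt_gt0 _] := hdiff_wt hv.
  by rewrite -scalerAr -exprS prednK.
rewrite -poisson_summation -scalerAr mulr_sumr scaler_sumr.
apply: eq_bigr => x _; rewrite fourier_hdiff //.
by rewrite -scalerAr -scalerAl !scalerA mulrC.
Qed.

Lemma horner_hpoly_dual (i j : 'I_n) C (t : rat) : 1 + t != 0 ->
  (hpoly_dual i j C).[t]
  = (1 + t) ^+ (n - 2) * (hpoly i j C).[(1 - t) / (1 + t)].
Proof.
move=> nz; rewrite !horner_sum mulr_sumr; apply: eq_bigr => x _.
have [->|hx] := eqVneq (hdiff i j x) 0.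
  by rewrite !scale0r !horner0 mulr0.
have /andP[wt_gt0 wt_ltn] := hdiff_wt hx.
have hm : (1 - 'X).[t] = 1 - t by rewrite !hornerE.
have hp : (1 + 'X).[t] = 1 + t by rewrite !hornerE.
rewrite !hornerZ hornerM !horner_exp hm hp hornerX.
rewrite [RHS]mulrCA; congr (_ * _).
have -> : (n - 2 = (n - wt x).-1 + (wt x).-1)%N by lia.
by rewrite exprD -mulrA -exprMn mulrCA mulfV // mulr1 mulrC.
Qed.

Lemma coef_hpoly (i j : 'I_n) C (w : nat) : (0 < w)%N ->
  (hpoly i j C)`_w.-1 = \sum_(x in C | wt x == w) hdiff i j x.
Proof.
move=> w_gt0; rewrite coef_sum [RHS]big_mkcondr; apply: eq_bigr => x _.
rewrite coefZ coefXn; have [->|hx] := eqVneq (hdiff i j x) 0.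
  by rewrite mul0r if_same.
have /andP[wt_gt0 _] := hdiff_wt hx.
have -> : (w.-1 == (wt x).-1) = (wt x == w) by apply/eqP/eqP; lia.
by case: ifP; rewrite ?mulr1 ?mulr0.
Qed.

(** * Even formally self-dual codes *)

Lemma inner_ones x : inner (const_mx 1) x = (wt x)%:R.
Proof.
rewrite /wt -sum1_card natr_sum big_mkcond; apply: eq_bigr => k _.
by rewrite inE !mxE mul1r; case: (F2_cases (x 0 k)) => ->.
Qed.

Lemma dvd2_wt x : (2 %| wt x)%N = (inner (const_mx 1) x == 0).
Proof. by rewrite inner_ones (dvdn_pcharf (pchar_Fp (isT : prime 2))). Qed.

Lemma wt_add_ones x : wt (const_mx 1 + x) = (n - wt x)%N.
Proof.
rewrite /wt (_ : supp _ = ~: supp x) 1?cardsCs ?setCK ?card_ord //.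
apply/setP=> k; rewrite !inE !mxE.
by case: (F2_cases (x 0 k)) => ->.
Qed.

Lemma wt_eq0 x : (wt x == 0%N) = (x == 0).
Proof.
rewrite cards_eq0; apply/eqP/eqP => [/setP x0|->].
  by apply/rowP=> k; have := x0 k; rewrite !inE mxE => /negbFE/eqP.
by apply/setP=> k; rewrite !inE mxE eqxx.
Qed.

Lemma hamming_distE x y : hamming_dist x y = wt (x - y).
Proof.
by rewrite /hamming_dist /wt; congr #|pred_of_set _|; apply/setP=> k;
  rewrite !inE !mxE subr_eq0.
Qed.

Lemma weight_distribution_gt0 C w :
  (0 < weight_distribution C w)%N <-> exists2 x, x \in C & wt x = w.
Proof.
split=> [/card_gt0P[x]|[x xC xw]].
  by rewrite inE => /andP[xC /eqP]; exists x.
by apply/card_gt0P; exists x; rewrite inE xC xw eqxx.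
Qed.

(** Evenness puts the all-one word into the dual; as it is the only word of
    weight n, equality of the weight distributions puts it into the code. *)
Lemma efsd_ones C : even_formally_self_dual C ->
  const_mx 1 \in C /\ const_mx 1 \in dual_code C.
Proof.
move=> [evenC wdC].
have onesD : const_mx 1 \in dual_code C.
  by apply/mem_dual_code => y /evenC; rewrite dvd2_wt => /eqP.
split=> //.
have wt_ones : wt (const_mx 1 : 'rV['F_2]_n) = n.
  have /eqP wt0 : wt (0 : 'rV['F_2]_n) == 0%N by rewrite wt_eq0.
  by rewrite -[const_mx 1]addr0 wt_add_ones wt0 subn0.
have /weight_distribution_gt0[x xC wtx] : (0 < weight_distribution C n)%N.
  by rewrite wdC; apply/weight_distribution_gt0; exists (const_mx 1).
suff -> : const_mx 1 = x by [].
apply/eqP; rewrite -subr_eq0 -wt_eq0.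
suff -> : - x = x by rewrite wt_add_ones wtx subnn.
by apply/rowP=> k; rewrite mxE; case: (F2_cases (x 0 k)) => ->; apply/val_inj.
Qed.

Lemma efsd_dual C :
  even_formally_self_dual C -> even_formally_self_dual (dual_code C).
Proof.
move=> efsdC; have [evenC wdC] := efsdC; have [onesC _] := efsd_ones efsdC.
split=> [x /mem_dual_code xD|w]; last by rewrite dual_codeK wdC.
by rewrite dvd2_wt innerC xD.
Qed.

Lemma card_weight_distribution C :
  #|C| = (\sum_(w < n.+1) weight_distribution C w)%N.
Proof.
have wt_lt x : (wt x < n.+1)%N.
  by rewrite ltnS -[X in (_ <= X)%N]card_ord max_card.
rewrite -sum1_card (partition_big (fun x => Ordinal (wt_lt x)) xpredT) //=.
apply: eq_bigr => w _; rewrite sum1dep_card.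
by apply: eq_card => x; rewrite !inE.
Qed.

Lemma efsd_card C : even_formally_self_dual C ->
  #|dual_code C| = #|C| /\ (#|C| * #|C| = 2 ^ n)%N.
Proof.
move=> [_ wdC]; have E : #|dual_code C| = #|C|.
  by rewrite !card_weight_distribution; apply: eq_bigr => w _; rewrite wdC.
by split=> //; rewrite -{2}E card_dual_code.
Qed.

Lemma self_dual_efsd C : self_dual C -> even_formally_self_dual C.
Proof.
move=> CE; split=> [x xC|w]; last by rewrite -CE.
have /mem_dual_code/(_ x xC) xx0 : x \in dual_code C by rewrite -CE.
rewrite dvd2_wt; apply/eqP; rewrite -[RHS]xx0; apply: eq_bigr => k _.
by rewrite mxE mul1r; case: (F2_cases (x 0 k)) => ->; rewrite ?mulr0 ?mulr1.
Qed.

Lemma near_extremal_wt C x : near_extremal C -> x \in C -> x != 0 ->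
  (2 * (n %/ 8) <= wt x)%N.
Proof.
move=> [_ /(_ x 0) min_dist] xC x_neq0.
by rewrite hamming_distE subr0 in min_dist; rewrite min_dist ?mem0v.
Qed.

Lemma near_extremal_dual_wt C x :
  even_formally_self_dual C -> near_extremal C ->
  x \in dual_code C -> x != 0 -> (2 * (n %/ 8) <= wt x)%N.
Proof.
move=> [_ wdC] neC xD x_neq0.
have /weight_distribution_gt0[y yC yx] : (0 < weight_distribution C (wt x))%N.
  by rewrite wdC; apply/weight_distribution_gt0; exists x.
by rewrite -yx; apply: (near_extremal_wt neC) => //; rewrite -wt_eq0 yx wt_eq0.
Qed.

(** Adding the all-one word turns the lower bound on nonzero weights into an
    upper bound on the weights other than n. *)
Lemma middle_weights C (d : nat) x : const_mx 1 \in C ->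
  (forall y, y \in C -> y != 0 -> (d <= wt y)%N) ->
  x \in C -> (0 < wt x < n)%N -> (d <= wt x <= n - d)%N.
Proof.
move=> onesC minC xC /andP[wt_gt0 wt_ltn].
have lo : (d <= wt x)%N by apply: minC => //; rewrite -wt_eq0; lia.
suff : (d <= wt (const_mx 1 + x)%R)%N by rewrite wt_add_ones; lia.
by apply: minC; [exact: rpredD | rewrite -wt_eq0 wt_add_ones; lia].
Qed.

(** * Vanishing of the harmonic enumerator *)

(** Summing over the code and its dual makes the MacWilliams identity relate a
    single polynomial to itself, as required by [antiinvariant_eq0]; its
    exponents match with n = 4 u + 4, where u is one less than the minimum
    distance. *)
Lemma efsd_hpoly_eq0 C (i j : 'I_n) : (0 < n)%N -> (8 %| n)%N ->
  even_formally_self_dual C -> near_extremal C -> i != j ->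
  hpoly i j C + hpoly i j (dual_code C) = 0.
Proof.
move=> n_gt0 /dvdnP[m nE] efsdC neC neq_ij.
have efsdD := efsd_dual efsdC.
have [onesC onesD] := efsd_ones efsdC.
have [cardD cardC2] := efsd_card efsdC.
have n8 : (n %/ 8 = m)%N by rewrite nE mulnK.
have m_gt0 : (0 < m)%N by lia.
have minC y : y \in C -> y != 0 -> (2 * m <= wt y)%N.
  by rewrite -n8; apply: near_extremal_wt.
have minD y : y \in dual_code C -> y != 0 -> (2 * m <= wt y)%N.
  by rewrite -n8; apply: near_extremal_dual_wt.
have wtP x : (x \in C) || (x \in dual_code C) -> hdiff i j x != 0 ->
    [/\ (2 * m <= wt x)%N, (wt x <= 6 * m)%N & ~~ odd (wt x)].
  move=> xCD /hdiff_wt wtx; suff [/andP[lo hi] ev] :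
      (2 * m <= wt x <= n - 2 * m)%N /\ (2 %| wt x)%N.
    by split; rewrite -?dvdn2 //; lia.
  case/orP: xCD => xC; split.
  - exact: middle_weights onesC minC xC wtx.
  - by case: efsdC => evenC _; apply: evenC.
  - exact: middle_weights onesD minD xC wtx.
  - by case: efsdD => evenD _; apply: evenD.
have cardC : #|C| = (2 ^ (4 * m))%N.
  apply/eqP; rewrite -(@eqn_exp2r _ _ 2) // -expnM -mulnn cardC2 nE.
  by apply/eqP; congr (_ ^ _)%N; lia.
set u := (2 * m).-1; set g := _ + _.
have gE : 2 ^+ (4 * m) *: g
          = (-2) *: (hpoly_dual i j C + hpoly_dual i j (dual_code C)).
  have macC := macwilliams_hdiff C neq_ij.
  have := macwilliams_hdiff (dual_code C) neq_ij.
  rewrite dual_codeK cardD => macD.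
  by rewrite -natrX -cardC !scalerDr macC macD addrC.
have c_neq0 : 2 ^+ (4 * m) != 0 :> rat by rewrite expf_neq0.
(* By gE, divisors of the transformed sum also divide g. *)
have dvd_g p :
    (forall x, (x \in C) || (x \in dual_code C) -> hdiff i j x != 0 ->
      p %| (1 - 'X) ^+ (wt x).-1 * (1 + 'X) ^+ (n - wt x).-1) -> p %| g.
  move=> dvdp; rewrite -(dvdpZr _ _ c_neq0) gE dvdpZr //.
  by apply: dvdp_add; apply: dvdp_sum => x xC;
    have [->|hx] := eqVneq (hdiff i j x) 0;
    rewrite ?scale0r ?dvdp0 // dvdpZr // dvdp ?xC ?orbT.
apply: (@antiinvariant_eq0 u).
- rewrite /u; lia.
- apply: leq_trans (size_polyD _ _) _; rewrite geq_max.
  apply/andP; split; apply: (leq_trans (size_sum _ _ _));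
    apply/bigmax_leqP => x xC;
    have [->|hx] := eqVneq (hdiff i j x) 0;
    rewrite ?scale0r ?size_poly0 //; apply: (leq_trans (size_scale_leq _ _));
    have [] := wtP x _ hx; rewrite ?xC ?orbT // size_polyXn /u; lia.
- apply: dvdp_add; apply: dvdp_sum => x xC;
    have [->|hx] := eqVneq (hdiff i j x) 0;
    rewrite ?scale0r ?dvdp0 // dvdpZr // dvdp_exp2l //;
    have [] := wtP x _ hx; rewrite ?xC ?orbT // /u; lia.
- apply: dvd_g => x xC hx; apply: dvdp_mulr; apply: dvdp_exp2l.
  by have [] := wtP x xC hx; rewrite /u; lia.
- apply: dvd_g => x xC hx; apply: dvdp_mull; apply: dvdp_exp2l.
  by have [] := wtP x xC hx; rewrite /u; lia.
- move=> t; rewrite !hornerD opprD !horner_sum -!sumrN.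
  congr (_ + _); apply: eq_bigr => x xC;
    have [->|hx] := eqVneq (hdiff i j x) 0;
    rewrite ?scale0r ?horner0 ?oppr0 // !hornerZ !hornerXn exprNn -signr_odd;
    have [] := wtP x _ hx; rewrite ?xC ?orbT // => lo hi ev;
    (have -> : odd (wt x).-1 by lia); by rewrite expr1 mulN1r mulrN.
- move=> t nz; have := congr1 (horner^~ t) gE.
  rewrite !hornerZ [(hpoly_dual _ _ _ + _).[_]]hornerD !horner_hpoly_dual //.
  rewrite -mulrDr -hornerD -/g.
  have -> : (4 * m = 2 * u + 1 + 1)%N by rewrite /u; lia.
  have -> : (n - 2 = 4 * u + 2)%N by rewrite /u; lia.
  rewrite exprD expr1 => E.
  have two : 2 != 0 :> rat by [].
  by apply: (mulfI two); rewrite mulrA [2 * _]mulrC E mulNr mulrN.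
Qed.

(** * Degrees of points in support designs *)

Definition point_degree (B : seq {set 'I_n}) (i : 'I_n) : nat :=
  count (fun b : {set 'I_n} => [set i] \subset b) B.

Lemma point_degree_support_blocks C (w : nat) (i : 'I_n) :
  point_degree (support_blocks C w) i
  = (\sum_(x in C | wt x == w) (x 0 i != 0)%R)%N.
Proof.
rewrite /point_degree /support_blocks count_map -sum1_count big_enum_cond /=.
rewrite big_mkcond [RHS]big_mkcond; apply: eq_bigr => x _ /=.
by rewrite sub1set !inE; case: (_ && (wt x == w)); case: (x 0 i != 0).
Qed.

Lemma sum_hdiff C (w : nat) (i j : 'I_n) :
  \sum_(x in C | wt x == w) hdiff i j x
  = (point_degree (support_blocks C w) i)%:R
    - (point_degree (support_blocks C w) j)%:R.
Proof. by rewrite !point_degree_support_blocks !natr_sum -sumrB. Qed.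

Lemma support_blocks_card C (w : nat) b : b \in support_blocks C w -> #|b| = w.
Proof.
by case/mapP=> x; rewrite mem_enum inE => /andP[_ /eqP <-] ->.
Qed.

Lemma t_design1 (B : seq {set 'I_n}) (w : nat) : (0 < n)%N ->
  (forall b, b \in B -> #|b| = w) ->
  (forall i j, point_degree B i = point_degree B j) -> t_design 1 B.
Proof.
move=> n_gt0 Bw Breg; exists n, w, (point_degree B (Ordinal n_gt0)); split=> //.
  by rewrite card_ord.
by move=> T /eqP/cards1P[i ->]; rewrite -(Breg i).
Qed.

Lemma efsd_point_degree C (w : nat) (i j : 'I_n) :
  (0 < n)%N -> (8 %| n)%N -> (0 < w)%N ->
  even_formally_self_dual C -> near_extremal C ->
  point_degree (support_blocks C w ++ support_blocks (dual_code C) w) i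
  = point_degree (support_blocks C w ++ support_blocks (dual_code C) w) j.
Proof.
move=> n_gt0 n8 w_gt0 efsdC neC; have [-> //|neq_ij] := eqVneq i j.
have := efsd_hpoly_eq0 n_gt0 n8 efsdC neC neq_ij.
move/(congr1 (fun p : {poly rat} => p`_w.-1)).
rewrite coefD coef0 !coef_hpoly // !sum_hdiff addrACA -opprD -!natrD.
by move/eqP; rewrite subr_eq0 eqr_nat /point_degree !count_cat => /eqP.
Qed.

End HarmonicEnumerators.

Theorem theorem1p1 (n : nat) (n_gt0 : (0 < n)%N) (n_mod8 : n = 0 %[mod 8])
    (C C' : {vspace 'rV['F_2]_n})
    (C_typeI : type_I C) (C_near_extremal : near_extremal C)
    (C'_efsd : even_formally_self_dual C')
    (C'_near_extremal : near_extremal C')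
    (w : nat) (w_gt0 : (0 < w)%N) :
  t_design 1 (support_blocks C w) /\
  t_design 1 (support_blocks C' w ++ support_blocks (dual_code C') w).
Proof.
have n8 : (8 %| n)%N by rewrite /dvdn n_mod8.
have [C_sd _] := C_typeI.
split; apply: (t_design1 (w := w) n_gt0).
- exact: support_blocks_card.
- move=> i j.
  (* For self-dual C the union counts each block of C twice. *)
  have := efsd_point_degree i j n_gt0 n8 w_gt0 (self_dual_efsd C_sd)
            C_near_extremal.
  rewrite -C_sd /point_degree !count_cat; lia.
- by move=> b; rewrite mem_cat => /orP[]; apply: support_blocks_card.
- by move=> i j; apply: efsd_point_degree.
Qed.
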